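(* Let $(N,\nu)$ be the conic production game defined by $(N,p,\mathcal{A},b,\mathcal{K})$, i.e. for every $S\subseteq N$, $$\nu(S)=\max\{\langle p,x\rangle:\ \mathcal{A}x=b(S),\ x\in\mathcal{K}\},\qquad b(S)=\sum_{i\in S}b(i).$$ If the conic program defining $\nu(N)$ for the grand coalition $N$ verifies the Slater condition, then the core of $(N,\nu)$ is nonempty.
   Context: $N$ is a finite set of agents; $b:N\to\mathbb{R}^m$ assigns to each agent a bundle of $m$ resources; $V$ is a finite-dimensional real vector space; $\mathcal{K}\subset V$ is a proper cone (pointed, closed, convex, with nonempty interior); $p\in V^*$ is a linear functional (vector of prices); $\mathcal{A}:V\to\mathbb{R}^m$ is linear. Here ''max'' denotes the optimal value of the program; since $(N,\nu)$ is a transferable utility (TU) game, $\nu$ is real-valued. The Slater condition for a conic program with constraints $\mathcal{A}x=b$, $x\in\mathcal{K}$ means that there is a feasible point in the interior of the cone: some $x\in\mathcal{K}^\circ$ (interior of $\mathcal{K}$) with $\mathcal{A}x=b$. The core of a TU game $(N,\nu)$ is the set of $z\in\mathbb{R}^N$ with $\sum_{i\in N}z_i=\nu(N)$ and $\sum_{i\in S}z_i\ge\nu(S)$ for all coalitions $\emptyset\ne S\subset N$. *)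

(* Defs.v *)
From HB Require Import structures.
From mathcomp Require Import all_boot all_order all_algebra.
From mathcomp Require Import all_classical all_reals all_analysis.

Set Implicit Arguments.
Unset Strict Implicit.
Unset Printing Implicit Defensive.

Import Order.TTheory GRing.Theory Num.Theory.
Import numFieldNormedType.Exports.

Local Open Scope classical_set_scope.
Local Open Scope ring_scope.

(* The usual topology of a finite-dimensional space, pulled back from R^n along
   coordinates in a basis; it does not depend on the choice of the basis.
   [fdtop V] is convertible to [V]. *)
Definition fdtop (R : realType) (V : vectType R) :=
  initial_topology (passmx.rVof (vbasis {:V}) : V -> 'rV[R]_(\dim {:V})).

HB.instance Definition _ (R : realType) (V : vectType R) :=
  Topological.on (fdtop V).

Definition fd_closed (R : realType) (V : vectType R) (K : set V) : Prop :=
  closed (K : set (fdtop V)).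

Definition fd_interior (R : realType) (V : vectType R) (K : set V) : set V :=
  interior (K : set (fdtop V)).

Record proper_cone (R : realType) (V : vectType R) (K : set V) : Prop := {
  proper_cone_scale : forall (t : R) (x : V), 0 <= t -> K x -> K (t *: x);
  proper_cone_convex : convex_set (K : set (convex_lmodType V));
  proper_cone_pointed : forall x : V, K x -> K (- x) -> x = 0;
  proper_cone_closed : fd_closed K;
  proper_cone_interior : fd_interior K !=set0
}.

Definition feasible (R : realType) (V : vectType R) (m : nat)
    (A : {linear V -> 'rV[R]_m}) (K : set V) (c : 'rV[R]_m) : set V :=
  [set x | A x = c /\ K x].

(* -oo if the program is infeasible, +oo if it is unbounded; attainment of a
   finite value is not required. *)
Definition optimal_value (R : realType) (V : vectType R) (m : nat)
    (p : {scalar V}) (A : {linear V -> 'rV[R]_m}) (K : set V)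
    (c : 'rV[R]_m) : \bar R :=
  ereal_sup [set (p x)%:E | x in feasible A K c].

Definition slater (R : realType) (V : vectType R) (m : nat)
    (A : {linear V -> 'rV[R]_m}) (K : set V) (c : 'rV[R]_m) : Prop :=
  exists2 x : V, fd_interior K x & A x = c.

Definition bundle (R : realType) (N : finType) (m : nat)
    (b : N -> 'rV[R]_m) (S : {set N}) : 'rV[R]_m :=
  \sum_(i in S) b i.

(* Since [nu] takes values in R, this makes every coalition's program feasible
   and bounded. *)
Definition conic_production_game (R : realType) (V : vectType R) (N : finType)
    (m : nat) (p : {scalar V}) (A : {linear V -> 'rV[R]_m})
    (b : N -> 'rV[R]_m) (K : set V) (nu : {set N} -> R) : Prop :=
  forall S : {set N}, (nu S)%:E = optimal_value p A K (bundle b S).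

Definition core (R : realType) (N : finType) (nu : {set N} -> R) :
    set (N -> R) :=
  [set z | \sum_(i : N) z i = nu (finset.setT : {set N}) /\
           forall S : {set N}, S != finset.set0 -> nu S <= \sum_(i in S) z i].

(* Main.v *)
Require Import Defs.
From HB Require Import structures.
From mathcomp Require Import all_boot all_order all_algebra.
From mathcomp Require Import all_classical all_reals all_analysis.
From mathcomp Require Import ring lra.

Set Implicit Arguments.
Unset Strict Implicit.
Unset Printing Implicit Defensive.

Import Order.TTheory GRing.Theory Num.Theory.
Import numFieldNormedType.Exports.

Local Open Scope classical_set_scope.
Local Open Scope ring_scope.

(** The core element comes from linear programming duality in the style of
    Owen: the shadow prices of the resources in the grand coalition's program.
    Suppose that [y] is a vector of resource prices with [p x <= cost y (A x)]
    on the cone [K] and [cost y (bundle b N) = nu N].  Paying agent [i] the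
    cost of [b i] distributes exactly [nu N], and every plan [x] feasible for
    [S] satisfies [p x <= cost y (A x) = cost y (bundle b S)], so [S] receives
    at least [nu S].

    The existence of [y] is strong conic duality under the Slater condition
    ([conic_strong_duality]), proved by M. Riesz's extension argument on
    subspaces of the resource space.  On the line spanned by [c := A x0], where
    [x0] is the Slater point, prices with [cost y c = nu N] are dual feasible
    because [K] is a cone and [nu N] is the finite supremum of the program for
    [c] ([supporting_line]).  They are then extended from a subspace [U] to
    [U + e], one dimension at a time ([supporting_step]): the price of the new
    direction [e] must lie above the values forced by the points of [K] that
    [A] sends into the translate of [U] by [e], and below those forced by the
    points sent into the translate by [- e].  Adding two such points shows that
    the bounds are compatible, and interiority of [x0] shows that one family is
    empty only if both are, so that a real number fits. *)

(** * Prices of resources *)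

(** The cost of the bundle [d] at the prices [y], i.e. the linear functional on
    the resource space with coordinates [y]. *)
Definition cost (R : realType) (m : nat) (y : 'cV[R]_m) (d : 'rV[R]_m) : R :=
  (d *m y) 0 0.

Section Cost.
Context {R : realType} {m : nat}.
Implicit Types (y w : 'cV[R]_m) (d : 'rV[R]_m).

Lemma costD y d1 d2 : cost y (d1 + d2) = cost y d1 + cost y d2.
Proof. by rewrite /cost mulmxDl mxE. Qed.

Lemma costZ y t d : cost y (t *: d) = t * cost y d.
Proof. by rewrite /cost -scalemxAl mxE. Qed.

Lemma cost_comb y w a d : cost (y + a *: w) d = cost y d + a * cost w d.
Proof. by rewrite /cost mulmxDr -scalemxAr !mxE. Qed.

Lemma cost_sum (I : finType) (P : pred I) (F : I -> 'rV[R]_m) y :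
  cost y (\sum_(i | P i) F i) = \sum_(i | P i) cost y (F i).
Proof. by rewrite /cost mulmx_suml summxE. Qed.

Lemma exists_cost_separating k (U : 'M[R]_(k, m)) (e : 'rV[R]_m) :
  ~~ (e <= U)%MS ->
  exists w, cost w e = 1 /\ forall u : 'rV[R]_m, (u <= U)%MS -> cost w u = 0.
Proof.
rewrite submxE => /rV0Pn[j ej].
exists (((e *m cokermx U) 0 j)^-1 *: col j (cokermx U)).
have colE d : cost (((e *m cokermx U) 0 j)^-1 *: col j (cokermx U)) d
    = ((e *m cokermx U) 0 j)^-1 * (d *m cokermx U) 0 j.
  rewrite /cost -scalemxAr !mxE; congr (_ * _).
  by apply: eq_bigr => i _; rewrite mxE.
split; first by rewrite colE mulVf.
by move=> u; rewrite submxE colE => /eqP ->; rewrite [X in _ * X]mxE mulr0.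
Qed.

End Cost.

(** * Points of a proper cone *)

Section ProperCone.
Context {R : realType} {V : vectType R} (K : set V).

Lemma proper_cone_add (x y : V) : proper_cone K -> K x -> K y -> K (x + y).
Proof.
move=> hK Kx Ky.
(* [x + y] is twice the midpoint. *)
have half_ge0 : (0 : R) <= 2^-1 by rewrite invr_ge0.
have half_le1 : (2^-1 : R) <= 1 by rewrite invf_le1// ler1n.
have := proper_cone_convex hK (Itv01 half_ge0 half_le1)
  (mem_set Kx) (mem_set Ky).
rewrite inE => /(proper_cone_scale hK (ler0n _ 2)).
rewrite [X in K X -> _](_ : _ = x + y)//.
rewrite /conv/= /unstable.onem scalerDr !scalerA mulrBr mulr1.
rewrite divff ?pnatr_eq0//.
by rewrite (_ : 2 - 1 = 1 :> R) ?scale1r//; ring.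
Qed.

(** The only topological fact used: one may move a little from an interior point
    in every direction without leaving the set. *)
Lemma fd_interior_absorbing (x d : V) :
  fd_interior K x -> exists2 eps : R, 0 < eps & K (x + eps *: d).
Proof.
move=> Kx.
pose f (t : R) : fdtop V := x + t *: d.
have fc : continuous f.
  apply: continuous_comp_initial => t.
  have -> : passmx.rVof (vbasis {:V}) \o f = fun r =>
      r *: passmx.rVof (vbasis {:V}) d + passmx.rVof (vbasis {:V}) x.
    by apply/funext => r; rewrite /f/= [x + _]addrC; exact: passmx.rVof_linear.
  by apply: cvgD; [exact: scalel_continuous | exact: cvg_cst].
have : nbhs (0 : R) (f @^-1` K).
  by apply: fc; rewrite /f scale0r addr0.
move=> /nbhs_ballP[e /= e0 eK]; exists (e / 2); first by rewrite divr_gt0.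
apply: eK; rewrite /ball/= sub0r normrN gtr0_norm ?divr_gt0//.
by rewrite ltr_pdivrMr// ltr_pMr// ltr1n.
Qed.

End ProperCone.

(** * Strong duality by one-dimensional extensions *)

Section Duality.
Context {R : realType} {V : vectType R} {m : nat}.
Context (p : {scalar V}) (A : {linear V -> 'rV[R]_m}) (K : set V).

(* The scalar action on the codomain of [p] as a multiplication. *)
Let priceZ t x : p (t *: x) = t * p x.
Proof. exact: linearZ. Qed.

(** The prices [y] are dual feasible for the part of the cone whose resource
    bundle lies in the row space of [U]. *)
Definition supporting {k} (U : 'M[R]_(k, m)) (y : 'cV[R]_m) : Prop :=
  forall x, K x -> (A x <= U)%MS -> p x <= cost y (A x).

Hypothesis Kscale : forall (t : R) (x : V), 0 <= t -> K x -> K (t *: x).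
Hypothesis Kadd : forall x y : V, K x -> K y -> K (x + y).

(* The Slater point, an algebraic interior point of [K]. *)
Variable x0 : V.
Hypothesis x0_absorbing :
  forall d : V, exists2 eps : R, 0 < eps & K (x0 + eps *: d).

Lemma absorbing_mem : K x0.
Proof. by have [e _] := x0_absorbing 0; rewrite scaler0 addr0. Qed.

Lemma absorbing_translate (d : V) : exists s : R, K (s *: x0 + d).
Proof.
have [e e0 Ke] := x0_absorbing d; exists e^-1.
have ie : 0 <= e^-1 by rewrite invr_ge0 ltW.
by have := Kscale ie Ke; rewrite scalerDr scalerA mulVf ?gt_eqF// scale1r.
Qed.

(** Adjoining a direction [e] to [U] leaves the prices on [U] unchanged and only
    requires a choice of the price of [e]: the new prices are [y + a *: w] for a
    functional [w] vanishing on [U] with value 1 at [e]. *)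
Lemma supporting_step k (U : 'M[R]_(k, m)) (e : 'rV[R]_m) y :
  (A x0 <= U)%MS -> supporting U y -> ~~ (e <= U)%MS ->
  exists y', (forall u : 'rV[R]_m, (u <= U)%MS -> cost y' u = cost y u) /\
    supporting (U + e)%MS y'.
Proof.
move=> cU Uy eU; have [w [we wU]] := exists_cost_separating eU.
(* [L] holds the lower bounds on the correction [a] to the price of [e], and the
   points of [H] provide the upper bounds. *)
pose L := [set p x - cost y (A x) |
  x in [set x | K x /\ ((A x - e)%R <= U)%MS]].
pose H := [set x | K x /\ ((A x + e)%R <= U)%MS].
have LH l x : L l -> H x -> l <= cost y (A x) - p x.
  move=> [z [Kz zU] <-] [Kx xU].
  have zxU : (A (z + x)%R <= U)%MS.
    rewrite raddfD -[X in X + _](subrK e) -addrA [e + _]addrC.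
    exact: addmx_sub zU xU.
  by have := Uy _ (Kadd Kz Kx) zxU; rewrite !raddfD costD /=; lra.
(* If [x] is in [H], then [- x] shifted far enough along [x0] lies in [K], and
   the shift changes its image only by an element of [U]. *)
have HL x : H x -> L !=set0.
  move=> [Kx xU]; have [s Ks] := absorbing_translate (- x).
  exists (p (s *: x0 - x) - cost y (A (s *: x0 - x))), (s *: x0 - x) => //.
  split=> //; rewrite raddfB /= linearZ /= -addrA -opprD.
  by rewrite addmx_sub ?scalemx_sub// -scaleN1r scalemx_sub.
(* If both families are empty any [a] would do; otherwise [a] is [sup L]. *)
have [a [La aH]] : exists a, (forall l, L l -> l <= a) /\
    (forall x, H x -> a <= cost y (A x) - p x).
  have [L0|/nonemptyPn L0] := pselect (L !=set0); last first.
    exists 0; split=> [l|x /HL[l]]; by rewrite L0.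
  have [[x Hx]|/nonemptyPn H0] := pselect (H !=set0); last first.
    (* The same shift, in the opposite direction. *)
    have [l [z [Kz zU] zl]] := L0; exfalso.
    have [s Ks] := absorbing_translate (- z).
    suff : H (s *: x0 - z) by rewrite H0.
    split=> //; rewrite raddfB /= linearZ /= -addrA.
    rewrite -[- A z + e]opprK opprD opprK.
    by rewrite addmx_sub ?scalemx_sub// -scaleN1r scalemx_sub.
  exists (sup L); split.
    move=> l Ll; apply: ub_le_sup => //; exists (cost y (A x) - p x) => l' Ll'.
    exact: LH.
  by move=> z Hz; apply: ge_sup => // l Ll; exact: LH.
exists (y + a *: w); split.
  by move=> u uU; rewrite cost_comb wU// mulr0 addr0.
move=> x Kx /sub_addsmxP[[u1 u2] /= xE].
pose t := u2 0 0.
have {}xE : A x = u1 *m U + t *: e by rewrite xE (mx11_scalar u2) mul_scalar_mx.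
have uU : (u1 *m U <= U)%MS by exact: submxMl.
rewrite cost_comb [in X in _ + a * X]xE costD costZ we wU// add0r mulr1.
have [t0|t0|t0] := ltrgtP t 0.
- have Hx : H ((- t)^-1 *: x).
    split; first by apply: Kscale => //; rewrite invr_ge0; lra.
    rewrite linearZ /= xE scalerDr scalerA invrN mulNr mulVf ?lt_eqF//.
    by rewrite scaleN1r addrNK scalemx_sub.
  have := aH _ Hx; rewrite priceZ linearZ /= costZ -mulrBr.
  by rewrite ler_pdivlMl ?oppr_gt0//; lra.
- have Lx : L (p (t^-1 *: x) - cost y (A (t^-1 *: x))).
    exists (t^-1 *: x) => //.
    split; first by apply: Kscale => //; rewrite invr_ge0; lra.
    rewrite linearZ /= xE scalerDr scalerA mulVf ?gt_eqF//.
    by rewrite scale1r addrK scalemx_sub.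
  have := La _ Lx; rewrite priceZ linearZ /= costZ -mulrBr.
  by rewrite ler_pdivrMl//; lra.
- rewrite t0 mulr0 addr0; apply: Uy => //.
  by rewrite xE t0 scale0r addr0.
Qed.

Lemma supporting_extension k (U : 'M[R]_(k, m)) y :
  (A x0 <= U)%MS -> supporting U y ->
  exists y', cost y' (A x0) = cost y (A x0) /\
    forall x, K x -> p x <= cost y' (A x).
Proof.
have [n] := ubnP (m - \rank U).
elim: n k U y => // n IH k U y rU cU Uy.
have [fU|] := boolP (1%:M <= U)%MS.
  exists y; split=> // x Kx; apply: Uy => //.
  by apply: submx_trans fU; exact: submx1.
move=> /row_subPn[i eU].
have [y1 [y1U Uy1]] := supporting_step cU Uy eU.
have UUe : (U < U + row i 1%:M)%MS.
  rewrite ltmxE addsmxSl/=; apply: contra eU; apply: submx_trans.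
  exact: addsmxSr.
have := rank_ltmx UUe => rlt.
have rle : (\rank (U + row i 1%:M) <= m)%N := rank_leq_col _.
have rn : (m - \rank (U + row i 1%:M)%MS < n)%N.
  exact: leq_trans (ltn_sub2l (leq_trans rlt rle) rlt) rU.
have cUe : (A x0 <= U + row i 1%:M)%MS.
  by apply: submx_trans cU _; exact: addsmxSl.
have [y2 [y2c y2K]] := IH _ _ y1 rn cUe Uy1.
by exists y2; split=> //; rewrite y2c y1U.
Qed.

Variable v : R.
Hypothesis v_sup : (v%:E = optimal_value p A K (A x0))%E.

Lemma optimal_value_ub x : K x -> A x = A x0 -> p x <= v.
Proof.
move=> Kx Ax; rewrite -lee_fin v_sup; apply: ereal_sup_ubound.
by exists x.
Qed.

(** A point of [K] in the kernel of [A] is a recession direction of the program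
    for [A x0]; a positive price along it would make the program unbounded. *)
Lemma recession_ker x : K x -> A x = 0 -> p x <= 0.
Proof.
move=> Kx Ax; rewrite leNgt; apply/negP => px.
have vx0 := optimal_value_ub absorbing_mem erefl.
(* The plan [x0 + s *: x] has price [v + 1]. *)
pose s := (v - p x0 + 1) / p x.
have s0 : 0 <= s by rewrite divr_ge0 ?ltW//; lra.
have := optimal_value_ub (Kadd absorbing_mem (Kscale s0 Kx)).
rewrite !raddfD /= priceZ linearZ /= Ax scaler0 addr0 => /(_ erefl).
by rewrite /s divfK ?gt_eqF//; lra.
Qed.

(** The base of the extension.  For [A x = t *: A x0] with [t < 0], every [z]
    feasible for [A x0] gives the point [z - t^-1 *: x] of [K] in the kernel of
    [A], whence [p z <= t^-1 * p x]; the supremum over [z] bounds [v]. *)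
Lemma supporting_line y : cost y (A x0) = v -> supporting (A x0) y.
Proof.
move=> yc x Kx /sub_rVP[t xE]; rewrite xE costZ yc.
have [t0|t0|t0] := ltrgtP t 0.
- have h z : K z -> A z = A x0 -> p z <= t^-1 * p x.
    move=> Kz Az; have nt : 0 <= (- t)^-1 by rewrite invr_ge0; lra.
    have := recession_ker (Kadd Kz (Kscale nt Kx)).
    rewrite !raddfD /= priceZ linearZ /= Az xE scalerA invrN mulNr.
    by rewrite mulVf ?lt_eqF// scaleN1r subrr mulNr => /(_ erefl); lra.
  have : v <= t^-1 * p x.
    rewrite -lee_fin v_sup; apply: ge_ereal_sup => _ [z [Az Kz] <-].
    by rewrite lee_fin h.
  by rewrite ler_ndivlMl// mulrC.
- have it : 0 <= t^-1 by rewrite invr_ge0 ltW.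
  have := optimal_value_ub (Kscale it Kx).
  rewrite priceZ linearZ /= xE scalerA mulVf ?gt_eqF// scale1r => /(_ erefl).
  by rewrite ler_pdivrMl.
- by rewrite t0 mul0r; apply: recession_ker => //; rewrite xE t0 scale0r.
Qed.

(** If [A x0 = 0], the program is homogeneous and its finite value can only be
    0, so the condition on [y] is consistent in this case too. *)
Lemma exists_cost_value : exists y, cost y (A x0) = v.
Proof.
have [c0|c0] := eqVneq (A x0) 0.
  exists 0; rewrite /cost mulmx0 mxE.
  have v0 : v <= 0.
    rewrite -lee_fin v_sup; apply: ge_ereal_sup => _ [z [Az Kz] <-].
    by rewrite lee_fin recession_ker// Az.
  have K0 : K 0.
    by rewrite -(scale0r x0); apply: Kscale => //; exact: absorbing_mem.
  have := optimal_value_ub K0; rewrite !raddf0 => /(_ (esym c0)); lra.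
have [|w [wc _]] := @exists_cost_separating R m m 0 (A x0).
  by rewrite submx0.
by exists (v *: w); rewrite -[_ *: w]add0r cost_comb wc /cost mulmx0 mxE; lra.
Qed.

(** Under the Slater condition a finite primal value [v] is attained by a dual
    feasible solution [y].  Attainment in the primal is not needed. *)
Lemma conic_strong_duality : exists y,
  cost y (A x0) = v /\ forall x, K x -> p x <= cost y (A x).
Proof.
have [y yc] := exists_cost_value.
have [y' [y'c y'K]] := supporting_extension (submx_refl _) (supporting_line yc).
by exists y'; rewrite y'c.
Qed.

End Duality.

Theorem theorem7 (R : realType) (V : vectType R) (N : finType) (m : nat)
    (p : {scalar V}) (A : {linear V -> 'rV[R]_m}) (b : N -> 'rV[R]_m)
    (K : set V) (nu : {set N} -> R) :
  proper_cone K ->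
  conic_production_game p A b K nu ->
  slater A K (bundle b (finset.setT : {set N})) ->
  core nu !=set0.
Proof.
move=> hK hnu [x0 Kx0 Ax0].
have nuN := hnu finset.setT; rewrite -Ax0 in nuN.
have [y [yc yK]] := conic_strong_duality (proper_cone_scale hK)
  (fun x z => proper_cone_add hK) (fun d => fd_interior_absorbing d Kx0) nuN.
have costS (S : {set N}) : \sum_(i in S) cost y (b i) = cost y (bundle b S).
  by rewrite /bundle cost_sum.
exists (fun i => cost y (b i)); split.
  rewrite -yc Ax0 -costS; apply: eq_bigl => i.
  by rewrite finset.in_setT.
move=> S _; rewrite costS -lee_fin hnu; apply: ge_ereal_sup => _ [x [Ax Kx] <-].
by rewrite lee_fin -Ax yK.
Qed.
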